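(* Suppose $\Sigma_0=\Sigma$ and $\beta_0\neq\beta$ (regression shift). Let $\mathscr R(\lambda,\phi)$ be the deterministic risk equivalent defined in the context, let $\lambda^*\in\arg\min_{\lambda\ge\lambda_{\min}(\phi)}\mathscr R(\lambda,\phi)$, and let $B=\beta\beta^\top$, $B_0=\beta_0\beta^\top$. Consider the condition $$\text{(A)}\qquad \overline{\mathrm{tr}}[B_0\Sigma^2(\Sigma+\mu I)^{-2}]>\overline{\mathrm{tr}}[B\Sigma^2(\Sigma+\mu I)^{-2}]\quad\text{for all }\mu\ge0.$$ (1) (Underparameterized) If $\phi<1$, condition (A) holds, and $\sigma^2=o(1)$, then $\lambda^*<0$; that is, if $\phi<1$ and (A) holds, there is $\bar\sigma^2>0$ (depending on the other parameters) such that $\lambda^*<0$ whenever $\sigma^2<\bar\sigma^2$. (2) (Overparameterized) If $\phi>1$, condition (A) holds, and for all $0<v<1/\mu(0,\phi)$ $$\frac{\overline{\mathrm{tr}}[B\Sigma(v\Sigma+I)^{-2}]+\sigma^2}{\overline{\mathrm{tr}}[B\Sigma(v\Sigma+I)^{-3}]+\sigma^2}>\frac{\overline{\mathrm{tr}}[\Sigma(v\Sigma+I)^{-2}]}{\overline{\mathrm{tr}}[\Sigma(v\Sigma+I)^{-3}]},$$ then $\lambda^*<0$.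
   Context: Notation: $\overline{\mathrm{tr}}[A]=\mathrm{tr}[A]/p$ for $A\in\mathbb R^{p\times p}$. Parameters: $\Sigma,\Sigma_0\in\mathbb R^{p\times p}$ are deterministic symmetric matrices with eigenvalues bounded away from $0$ and $+\infty$ (uniformly in $p$), the feature covariances of the train and test distributions; $\beta,\beta_0\in\mathbb R^p$ are the $L_2$ linear projection coefficients of the train and test responses on the features; $\sigma^2,\sigma_0^2\ge 0$ are the corresponding noise variances; $\phi\in(0,\infty)$ is the limit of $p/n$. Let $r_{\min}$ be the smallest eigenvalue of $\Sigma$. Let $\mu_{\min}>-r_{\min}$ be the unique solution of $1=\phi\,\overline{\mathrm{tr}}[\Sigma^2(\Sigma+\mu_{\min}I)^{-2}]$, and let $\lambda_{\min}(\phi)=\mu_{\min}-\phi\,\overline{\mathrm{tr}}[\mu_{\min}\Sigma(\Sigma+\mu_{\min}I)^{-1}]$. For $\lambda>\lambda_{\min}(\phi)$, $\mu=\mu(\lambda,\phi)$ is the unique solution with $\mu>\mu_{\min}$ of $\mu=\lambda+\phi\,\overline{\mathrm{tr}}[\mu\Sigma(\Sigma+\mu I)^{-1}]$, and $$\tilde v=\frac{\phi\,\overline{\mathrm{tr}}[\Sigma_0\Sigma(\Sigma+\mu I)^{-2}]}{1-\phi\,\overline{\mathrm{tr}}[\Sigma^2(\Sigma+\mu I)^{-2}]}.$$ The deterministic equivalent of the ridge prediction risk is $\mathscr R(\lambda,\phi)=\mathscr B+\mathscr V+\mathscr S+\kappa^2$ with $\mathscr B=\mu^2\beta^\top(\Sigma+\mu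 I)^{-1}(\tilde v\Sigma+\Sigma_0)(\Sigma+\mu I)^{-1}\beta$, $\mathscr V=\sigma^2\tilde v$, $\mathscr S=2\mu\,\beta^\top(\Sigma+\mu I)^{-1}\Sigma_0(\beta_0-\beta)$, $\kappa^2=(\beta_0-\beta)^\top\Sigma_0(\beta_0-\beta)+\sigma_0^2$. The minimization is over the extended reals (values at $\lambda=\lambda_{\min}(\phi)$ and $\lambda=+\infty$ are understood as limits, possibly $+\infty$); if there are several minimizers, the assertion about $\lambda^*$ holds for any of them. *)

(* Defs.v *)
From HB Require Import structures.
From mathcomp Require Import all_boot all_order all_algebra.
From mathcomp Require Import all_classical all_reals all_analysis.

Set Implicit Arguments.
Unset Strict Implicit.
Unset Printing Implicit Defensive.

Import Order.TTheory GRing.Theory Num.Theory.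
Import numFieldNormedType.Exports.

Local Open Scope classical_set_scope.
Local Open Scope ring_scope.

Section RidgeRisk.
Variables (R : realType) (p : nat).
Implicit Types (Sigma : 'M[R]_p) (beta : 'cV[R]_p).
Implicit Types (phi mu lambda sigma : R).

Definition ntr (A : 'M[R]_p) : R := \tr A / p%:R.

(* (Sigma + mu I)^{-1}; [invmx] is the identity on singular matrices, but
   Sigma + mu I is invertible wherever mu > - rmin Sigma. *)
Definition resolvent Sigma mu : 'M[R]_p := invmx (Sigma + mu%:M).

(* x^T M y as a scalar *)
Definition bform (x : 'cV[R]_p) (M : 'M[R]_p) (y : 'cV[R]_p) : R :=
  (x^T *m M *m y) 0 0.

(* Each [xget 0 P] below denotes the unique real satisfying P; the default 0
   would only be returned if there were none. *)
Definition rmin Sigma : R :=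
  xget 0 [set r | eigenvalue Sigma r /\
                  forall a, eigenvalue Sigma a -> r <= a].

Definition mumin Sigma phi : R :=
  xget 0 [set m | - rmin Sigma < m /\
                  1 = phi * ntr (Sigma ^+ 2 *m resolvent Sigma m ^+ 2)].

Definition lambdamin Sigma phi : R :=
  let m := mumin Sigma phi in
  m - phi * ntr (m *: (Sigma *m resolvent Sigma m)).

(* mu(lambda, phi), meaningful for lambda > lambdamin Sigma phi *)
Definition mufix Sigma phi lambda : R :=
  xget 0 [set m | mumin Sigma phi < m /\
                  m = lambda + phi * ntr (m *: (Sigma *m resolvent Sigma m))].

Definition vtilde Sigma Sigma0 phi lambda : R :=
  let mu := mufix Sigma phi lambda in
  phi * ntr (Sigma0 *m Sigma *m resolvent Sigma mu ^+ 2) /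
  (1 - phi * ntr (Sigma ^+ 2 *m resolvent Sigma mu ^+ 2)).

Definition bias Sigma Sigma0 beta phi lambda : R :=
  let mu := mufix Sigma phi lambda in
  mu ^+ 2 * bform beta
    (resolvent Sigma mu *m (vtilde Sigma Sigma0 phi lambda *: Sigma + Sigma0)
       *m resolvent Sigma mu) beta.

Definition variance_term Sigma Sigma0 sigma2 phi lambda : R :=
  sigma2 * vtilde Sigma Sigma0 phi lambda.

Definition shift_term Sigma Sigma0 beta beta0 phi lambda : R :=
  let mu := mufix Sigma phi lambda in
  2 * mu * bform beta (resolvent Sigma mu *m Sigma0) (beta0 - beta).

Definition kappa2 Sigma0 beta beta0 sigma02 : R :=
  bform (beta0 - beta) Sigma0 (beta0 - beta) + sigma02.

(* meaningful for lambda > lambdamin Sigma phi *)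
Definition risk Sigma Sigma0 beta beta0 sigma2 sigma02 phi lambda : R :=
  bias Sigma Sigma0 beta phi lambda
  + variance_term Sigma Sigma0 sigma2 phi lambda
  + shift_term Sigma Sigma0 beta beta0 phi lambda
  + kappa2 Sigma0 beta beta0 sigma02.

(* The risk on [lambdamin, +oo], extended by its limits, possibly infinite, at
   both ends; the values outside this interval are irrelevant. *)
Definition risk_ext Sigma Sigma0 beta beta0 sigma2 sigma02 phi
    (l : \bar R) : \bar R :=
  let rho := fun x : R =>
    (risk Sigma Sigma0 beta beta0 sigma2 sigma02 phi x)%:E in
  match l with
  | x%:E => if x == lambdamin Sigma phi
            then lim (rho y @[y --> (lambdamin Sigma phi)^'+])
            else rho x
  | +oo%E => lim (rho y @[y --> +oo])
  | -oo%E => +oo%E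
  end.

Definition risk_minimizer Sigma Sigma0 beta beta0 sigma2 sigma02 phi
    (l : \bar R) : Prop :=
  ((lambdamin Sigma phi)%:E <= l)%E /\
  forall l' : \bar R, ((lambdamin Sigma phi)%:E <= l')%E ->
    (risk_ext Sigma Sigma0 beta beta0 sigma2 sigma02 phi l <=
     risk_ext Sigma Sigma0 beta beta0 sigma2 sigma02 phi l')%E.

Definition aligned Sigma beta beta0 : Prop :=
  let B := beta *m beta^T in
  let B0 := beta0 *m beta^T in
  forall mu, 0 <= mu ->
    ntr (B0 *m Sigma ^+ 2 *m resolvent Sigma mu ^+ 2) >
    ntr (B *m Sigma ^+ 2 *m resolvent Sigma mu ^+ 2).

Definition overparam_condition Sigma beta sigma2 phi : Prop :=
  let B := beta *m beta^T in
  forall v : R, 0 < v -> v < (mufix Sigma phi 0)^-1 ->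
    let W := invmx (v *: Sigma + 1%:M) in
    (ntr (B *m Sigma *m W ^+ 2) + sigma2) /
    (ntr (B *m Sigma *m W ^+ 3) + sigma2) >
    ntr (Sigma *m W ^+ 2) / ntr (Sigma *m W ^+ 3).

End RidgeRisk.

(* Main.v *)
(* Diagonalizing Sigma turns every quantity into a function of mu which is a sum
   over eigenvalues s_k of rational functions of w_k = mu / (s_k + mu). The map
   mu |-> lambda is increasing beyond mumin, so it is enough to compare the risks
   at mu >= mu(0) with the risk at one suitable mu in ]mumin, mu(0)[; as
   lambdamin < 0, the endpoint lambdamin never matters, and at +oo it suffices
   that the risk converges.
   With F_j = sum_k a_k s_k w_k^j, E_j = sum_k s_k w_k^j and T2 = dof2, bias plus
   variance is (F_2 + sigma2) / (1 - T2) - sigma2, and condition (A) says that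
   the shift term has a positive derivative on [0, +oo[.
   - phi < 1: mu(0) = 0. Bias and variance are nonnegative, the shift term is
     nonnegative on [0, +oo[, and at mu = 0, sigma2 = 0 only the shift term has a
     nonzero derivative, so the risk falls below kappa2 slightly to the left.
   - phi > 1: up to the factor mu^2 / 2, the numerator of the derivative of bias
     plus variance is (F_2 - F_3) lambda
     + psi (F_2 E_3 - E_2 F_3 - sigma2 (E_2 - E_3)) with psi = phi / p; the
     hypothesis at v = 1 / mu makes it nonnegative for mu > mu(0), hence also at
     mu(0) by continuity. So the risk increases on [mu(0), +oo[ and just before
     mu(0). *)
Require Import Defs.
From HB Require Import structures.
From mathcomp Require Import all_boot all_order all_algebra.
From mathcomp Require Import all_classical all_reals all_analysis.
From mathcomp.real_closed Require Import complex.
From mathcomp Require Import ring lra.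

Set Implicit Arguments.
Unset Strict Implicit.
Unset Printing Implicit Defensive.

Import Order.TTheory GRing.Theory Num.Theory.
Import numFieldNormedType.Exports.

Local Open Scope classical_set_scope.
Local Open Scope ring_scope.

(** * Functional calculus of a real symmetric matrix through a unitary diagonalization *)

Section SpectralCalculus.
Local Open Scope sesquilinear_scope.
Variables (R : realType) (p : nat) (U : 'M[R[i]]_p).
Hypothesis U_unitary : U \is unitarymx.
Implicit Types (A B : 'M[R]_p) (f g : 'I_p -> R) (x y : 'cV[R]_p).

Local Notation toC := (map_mx (real_complex R)).

(** The conjugating matrix is complex because the spectral theorem in use is the one for normal
    matrices over R[i]; the spectral values stay real. *)
Definition spectral_mx f : 'M[R[i]]_p :=
  U^t* *m diag_mx (\row_k real_complex R (f k)) *m U.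

(* [A] = f(Sigma) when the k-th eigenvalue of Sigma is mapped to [f k]. *)
Definition fcalc A f := toC A = spectral_mx f.

Lemma spectral_mxM f g :
  spectral_mx f *m spectral_mx g = spectral_mx (fun k => f k * g k).
Proof.
have -> : spectral_mx (fun k => f k * g k) =
    U^t* *m (diag_mx (\row_k real_complex R (f k)) *m
             diag_mx (\row_k real_complex R (g k))) *m U.
  rewrite mulmx_diag; apply: (congr1 (fun D => _ *m diag_mx D *m U)).
  by apply/rowP => k; rewrite !mxE rmorphM.
by rewrite /spectral_mx !mulmxA (mulmxtVK _ U_unitary).
Qed.

Lemma spectral_mx1 : spectral_mx (fun=> 1) = 1%:M.
Proof.
rewrite /spectral_mx (_ : \row_k _ = const_mx 1); last first.
  by apply/rowP => k; rewrite !mxE rmorph1.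
by rewrite diag_const_mx mulmx1 (mulmx1C (unitarymxP U_unitary)).
Qed.

Lemma fcalcM A B f g :
  fcalc A f -> fcalc B g -> fcalc (A *m B) (fun k => f k * g k).
Proof.
by rewrite /fcalc -spectral_mxM => <- <-; exact: map_mxM.
Qed.

Lemma fcalcD A B f g :
  fcalc A f -> fcalc B g -> fcalc (A + B) (fun k => f k + g k).
Proof.
rewrite /fcalc; have -> : spectral_mx (fun k => f k + g k) =
    spectral_mx f + spectral_mx g.
  rewrite /spectral_mx -mulmxDl -mulmxDr -linearD.
  apply: (congr1 (fun D => _ *m diag_mx D *m U)).
  by apply/rowP => k; rewrite !mxE rmorphD.
by move=> <- <-; exact: map_mxD.
Qed.

Lemma fcalcZ a A f : fcalc A f -> fcalc (a *: A) (fun k => a * f k).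
Proof.
rewrite /fcalc; have -> : spectral_mx (fun k => a * f k) =
    real_complex R a *: spectral_mx f.
  rewrite /spectral_mx scalemxAl scalemxAr -linearZ.
  apply: (congr1 (fun D => _ *m diag_mx D *m U)).
  by apply/rowP => k; rewrite !mxE rmorphM.
by move=> <-; exact: map_mxZ.
Qed.

Lemma fcalc_scalar a : fcalc a%:M (fun=> a).
Proof.
rewrite -scalemx1 (_ : (fun=> a) = (fun=> a * 1)); last first.
  by apply/funext => k; rewrite mulr1.
by apply: fcalcZ; rewrite /fcalc map_mx1 spectral_mx1.
Qed.

Lemma fcalcX A f j : fcalc A f -> fcalc (A ^+ j) (fun k => f k ^+ j).
Proof.
move=> Af; elim: j => [|j IH]; first exact: fcalc_scalar.
rewrite exprS (_ : (fun k => _) = fun k => f k * f k ^+ j); first exact: fcalcM.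
by apply/funext => k; rewrite exprS.
Qed.

Lemma fcalcV A f :
  (forall k, f k != 0) -> fcalc A f -> fcalc (invmx A) (fun k => (f k)^-1).
Proof.
move=> f0 Af; have Ainv : toC A *m spectral_mx (fun k => (f k)^-1) = 1%:M.
  rewrite Af spectral_mxM -spectral_mx1; congr spectral_mx.
  by apply/funext => k; rewrite divff.
have Au := (mulmx1_unit Ainv).1.
rewrite /fcalc -[RHS](mulKmx Au) Ainv mulmx1; exact: map_invmx.
Qed.

Lemma fcalc_tr A f : fcalc A f -> \tr A = \sum_k f k.
Proof.
move=> Af; apply: (@complexI R); rewrite -trace_map_mx rmorph_sum.
rewrite [X in \tr X]Af mxtrace_mulC mulmxA (unitarymxP U_unitary) mul1mx.
by rewrite mxtrace_diag; apply: eq_bigr => k _; rewrite mxE.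
Qed.

(* x^T P_k y for the k-th spectral projector, up to an imaginary part which
   cancels in every sum over [k] against a function of the eigenvalue. *)
Definition spectral_weight x y k : R :=
  complex.Re (Num.conj ((U *m map_mx (real_complex R) x) k 0)
              * (U *m map_mx (real_complex R) y) k 0).

Lemma spectral_weight_ge0 x k : 0 <= spectral_weight x x k.
Proof.
by have := mul_conjC_ge0 ((U *m map_mx (real_complex R) x) k 0);
   rewrite mulrC lecE => /andP[].
Qed.

Lemma fcalc_bform A f x y :
  fcalc A f -> bform x A y = \sum_k spectral_weight x y k * f k.
Proof.
(* The scalar is real, hence equal to the real part of its embedding; [Re] is additive and can then
   be taken termwise. *)
move=> Af; rewrite -[LHS]/(complex.Re (real_complex R (bform x A y))).
have -> : real_complex R (bform x A y) = (toC (x^T *m A *m y)) 0 0.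
  by rewrite mxE.
have xT : toC x^T = (toC x)^t*.
  by apply/matrixP => i j; rewrite !mxE -[RHS]/(Complex _ (- 0)) oppr0.
have -> : toC (x^T *m A *m y) =
    (U *m toC x)^t* *m diag_mx (\row_k real_complex R (f k)) *m (U *m toC y).
  rewrite !map_mxM Af /spectral_mx trmx_mul map_mxM !mulmxA.
  by rewrite xT.
rewrite mul_mx_diag mxE raddf_sum; apply: eq_bigr => k _.
rewrite mxE /spectral_weight.
set u := U *m _; set v := U *m _.
rewrite [X in X * _ * _]mxE [X in Num.conj X]mxE [X in _ * X * _]mxE mulrAC.
by case: (_ * v k 0) => a b /=; rewrite mulr0 subr0.
Qed.

Lemma fcalc_unitmx A f : fcalc A f -> (A \in unitmx) = [forall k, f k != 0].
Proof.
move=> Af; rewrite -(map_unitmx (real_complex R)) Af.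
have Uu := unitarymx_unit U_unitary.
have Uu' : U^t* \in unitmx by rewrite -invmx_unitary // unitmx_inv.
rewrite /spectral_mx !unitmx_mul Uu Uu' /= andbT unitmxE det_diag unitfE.
apply/prodf_neq0/forallP => f0 k; last first.
  by move=> _; rewrite mxE fmorph_eq0.
by have := f0 k isT; rewrite mxE fmorph_eq0.
Qed.

(** Being an eigenvalue amounts to singularity of A - a I, whose spectral values are f k - a. *)
Lemma fcalc_eigenvalueP A f a :
  fcalc A f -> eigenvalue A a <-> exists k, a = f k.
Proof.
move=> Af; rewrite /eigenvalue /eigenspace kermx_eq0 row_free_unit.
have /fcalc_unitmx -> : fcalc (A - a%:M) (fun k => f k - a).
  rewrite -scaleN1r (_ : (fun k => _) = fun k => f k + -1 * a).
    exact/fcalcD/fcalcZ/fcalc_scalar.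
  by apply/funext => k; rewrite mulN1r.
rewrite negb_forall; split=> [/existsP[k]|[k ->]].
  by rewrite negbK subr_eq0 => /eqP <-; exists k.
by apply/existsP; exists k; rewrite subrr eqxx.
Qed.

End SpectralCalculus.

(** A real symmetric matrix is Hermitian over R[i], so its complex spectral values are real and
    taking [Re] loses nothing. *)
Lemma symmetric_fcalc (R : realType) (p : nat) (A : 'M[R]_p) : A^T = A ->
  exists (U : 'M[R[i]]_p) (f : 'I_p -> R), U \is unitarymx /\ fcalc U A f.
Proof.
move=> symA; pose B := map_mx (real_complex R) A.
have Bherm : B \is hermsymmx.
  apply: realsym_hermsym.
    by apply/is_hermitianmxP; rewrite expr0 scale1r map_mx_id// /B map_trmx symA.
  by apply/mxOverP => i j; rewrite mxE complex_real.
exists (spectralmx B), (fun k => complex.Re (spectral_diag B 0 k)).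
split; first exact: spectral_unitarymx.
have /hermitian_normalmx/orthomx_spectralP E := Bherm.
rewrite /fcalc /spectral_mx -invmx_unitary ?spectral_unitarymx //.
rewrite [LHS]E; apply: (congr1 (fun D => _ *m diag_mx D *m _)).
apply/rowP => k.
rewrite mxE; apply/esym/RRe_real.
by have /mxOverP := hermitian_spectral_diag_real Bherm.
Qed.

(** * Derivative rules for functions written pointwise *)

Section DeriveFun.
Variables (R : realType).
Implicit Types (f g : R -> R) (c m a b : R).

Lemma is_derive_cst_fun c m : is_derive m 1 (fun=> c) 0.
Proof. exact: is_derive_cst. Qed.

Lemma is_deriveD_fun f g m a b : is_derive m 1 f a -> is_derive m 1 g b ->
  is_derive m 1 (fun x => f x + g x) (a + b).
Proof. exact: is_deriveD. Qed.

Lemma is_deriveM_fun f g m a b : is_derive m 1 f a -> is_derive m 1 g b ->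
  is_derive m 1 (fun x => f x * g x) (f m * b + g m * a).
Proof. exact: is_deriveM. Qed.

Lemma is_deriveMl_fun c f m a : is_derive m 1 f a ->
  is_derive m 1 (fun x => c * f x) (c * a).
Proof. exact: is_deriveZ. Qed.

Lemma is_derive_sum_fun n (f : 'I_n -> R -> R) (a : 'I_n -> R) m :
  (forall k, is_derive m 1 (f k) (a k)) ->
  is_derive m 1 (fun x => \sum_k f k x) (\sum_k a k).
Proof. by move=> df; rewrite -fct_sumE; exact: is_derive_sum. Qed.

Lemma is_derive_sqr_fun f m a : is_derive m 1 f a ->
  is_derive m 1 (fun x => f x ^+ 2) (2 * f m * a).
Proof.
move=> df; apply: is_derive_eq (is_deriveX 2 df) _.
by rewrite expr1.
Qed.

Lemma is_derive_recip c a m : c + m != 0 ->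
  is_derive m 1 (fun x => a / (c + x)) (- a / (c + m) ^+ 2).
Proof.
move=> cm.
have dden : is_derive m 1 (fun x => c + x) (0 + 1) by exact: is_deriveD_fun.
apply: is_derive_eq (is_deriveMl_fun a (is_deriveV cm dden)) _.
by rewrite /GRing.scale /=; field.
Qed.

Lemma is_derive_homographic c m : c + m != 0 ->
  is_derive m 1 (fun x => x / (c + x)) (c / (c + m) ^+ 2).
Proof.
move=> cm.
have dden : is_derive m 1 (fun x => c + x) (0 + 1) by exact: is_deriveD_fun.
have did : is_derive m 1 (fun x : R => x) 1 := is_derive_id m 1.
apply: is_derive_eq (is_deriveM_fun did (is_deriveV cm dden)) _.
by rewrite /GRing.scale /=; field.
Qed.

Lemma is_derive_continuous f m a : is_derive m 1 f a -> {for m, continuous f}.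
Proof.
by move=> [df _]; apply/differentiable_continuous; rewrite -derivable1_diffP.
Qed.

End DeriveFun.

(** * The map from mu to lambda and its critical point *)

Section FixedPoint.
Variables (R : realType) (n : nat) (s : 'I_n -> R) (psi : R).
Implicit Types m l x y : R.

(** With psi = phi / p, the equation [dof2 m = 1] is the one defining [mumin], and 1 - [dof2] is the
    derivative of [penalty]. *)
Definition dof2 m := psi * \sum_k (s k / (s k + m)) ^+ 2.
(** The fixed-point equation of mu(lambda, phi), solved for lambda. *)
Definition penalty m := m - psi * \sum_k m * (s k / (s k + m)).

Variables (k0 : 'I_n).
Hypotheses (s_gt0 : forall k, 0 < s k) (s_min : forall k, s k0 <= s k).
Hypothesis psi_gt0 : 0 < psi.

Lemma shift_gt0 m k : - s k0 < m -> 0 < s k + m.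
Proof. by move=> hm; have := s_min k; lra. Qed.

Lemma is_derive_dof2 m : - s k0 < m ->
  is_derive m 1 dof2
    (psi * \sum_k 2 * (s k / (s k + m)) * (- s k / (s k + m) ^+ 2)).
Proof.
move=> hm; apply/is_deriveMl_fun/is_derive_sum_fun => k.
by apply/is_derive_sqr_fun/is_derive_recip; rewrite gt_eqF ?shift_gt0.
Qed.

Lemma penaltyB m1 m2 : - s k0 < m1 -> - s k0 < m2 ->
  penalty m2 - penalty m1 =
  (m2 - m1) * (1 - psi * \sum_k s k ^+ 2 / ((s k + m1) * (s k + m2))).
Proof.
move=> h1 h2; rewrite /penalty.
have E : (\sum_k s k ^+ 2 / ((s k + m1) * (s k + m2))) * (m2 - m1) =
  \sum_k m2 * (s k / (s k + m2)) - \sum_k m1 * (s k / (s k + m1)).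
  rewrite mulr_suml -sumrB; apply: eq_bigr => k _.
  have := shift_gt0 k h1; have := shift_gt0 k h2 => p1 p2.
  by field; rewrite !gt_eqF.
by rewrite mulrBr mulr1 mulrCA (mulrC (m2 - m1)) E; ring.
Qed.

Lemma dof2_decr m1 m2 : - s k0 < m1 -> m1 < m2 -> dof2 m2 < dof2 m1.
Proof.
move=> h1 h12; rewrite ltr_pM2l //; apply: ltr_sum => [|k _].
  by apply/hasP; exists k0; rewrite ?mem_index_enum.
have p1 := shift_gt0 k h1; have p2 := shift_gt0 k (lt_trans h1 h12).
rewrite ltr_pXn2r ?nnegrE ?divr_ge0 // ?ltW //.
by rewrite ltr_pM2l // ltf_pV2 // ltrD2l.
Qed.

(** The sum in the divided difference [penaltyB] is strictly smaller than the one in [dof2 m1].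
    Arguing this way also covers m1 = [mumin], where the derivative vanishes. *)
Lemma penalty_incr m1 m2 : - s k0 < m1 -> dof2 m1 <= 1 -> m1 < m2 ->
  penalty m1 < penalty m2.
Proof.
move=> h1 d1 h12; rewrite -subr_gt0 penaltyB ?(lt_trans h1 h12) //.
rewrite mulr_gt0 ?subr_gt0 // (lt_le_trans _ d1) // ltr_pM2l //.
apply: ltr_sum => [|k _].
  by apply/hasP; exists k0; rewrite ?mem_index_enum.
have p1 := shift_gt0 k h1; have p2 := shift_gt0 k (lt_trans h1 h12).
rewrite expr_div_n ltr_pM2l ?exprn_gt0 // ltf_pV2 ?posrE ?mulr_gt0 //.
by rewrite expr2 ltr_pM2l // ltrD2l.
Qed.

Lemma exists_dof2_eq1 : exists2 m : R, - s k0 < m & dof2 m = 1.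
Proof.
(* With this e, the k0 term of [dof2] alone equals 1 at - s k0 + e. *)
pose e := s k0 * Num.sqrt psi.
have e_gt0 : 0 < e by rewrite mulr_gt0 // sqrtr_gt0.
(* M is at least 1 and at least psi times the sum of the s_k^2, so this product is at most M^2 and
   [dof2 M <= 1]; the summand e keeps M to the right of the left endpoint. *)
pose M : R := 1 + e + psi * \sum_k s k ^+ 2.
have S0 : 0 <= psi * \sum_k s k ^+ 2.
  by rewrite mulr_ge0 ?sumr_ge0 ?ltW // => k _; exact: sqr_ge0.
have hl : - s k0 < - s k0 + e by rewrite ltrDl.
have lM : - s k0 + e <= M by have := s_gt0 k0; rewrite /M; lra.
have dl : 1 <= dof2 (- s k0 + e).
  rewrite /dof2 (bigD1 k0) //= addrA subrr add0r.
  rewrite invfM mulrA divff ?gt_eqF // mul1r exprVn sqr_sqrtr ?(ltW psi_gt0) //.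
  rewrite mulrDr divff ?gt_eqF // lerDl mulr_ge0 ?(ltW psi_gt0) //.
  by apply: sumr_ge0 => k _; exact: sqr_ge0.
have dM : dof2 M <= 1.
  have M0 : 0 < M by rewrite /M; lra.
  have : dof2 M <= psi * \sum_k s k ^+ 2 / M ^+ 2.
    rewrite ler_pM2l //; apply: ler_sum => k _; rewrite expr_div_n.
    have sM : 0 < s k + M by rewrite ltr_wpDr // ltW.
    rewrite ler_pM2l ?exprn_gt0 // lef_pV2 ?posrE ?exprn_gt0 //.
    by rewrite ler_pXn2r ?nnegrE ?(ltW sM) ?(ltW M0) // lerDr ltW.
  rewrite -mulr_suml mulrA => /le_trans; apply.
  rewrite ler_pdivrMr ?exprn_gt0 // mul1r expr2.
  rewrite (@le_trans _ _ M) ?ler_peMl ?ltW //; rewrite /M; lra.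
have ctn : {within `[- s k0 + e, M], continuous dof2}.
  apply: derivable_within_continuous => x; rewrite in_itv /= => /andP[hx _].
  by have [] := is_derive_dof2 (lt_le_trans hl hx).
have [|c] := IVT (v := 1) lM ctn.
  by rewrite ge_min dM orbT le_max dl.
by rewrite in_itv /= => /andP[hc _] dc; exists c => //; exact: lt_le_trans hc.
Qed.

Lemma exists_penalty_eq m l : - s k0 < m -> penalty m < l ->
  exists2 m' : R, m < m' & penalty m' = l.
Proof.
(* The sum subtracted in [penalty M] is at most psi times the sum of the s_k, which leaves at least
   |m| + |l|. *)
move=> hm ml; pose M : R := `|m| + `|l| + psi * \sum_k s k.
have S0 : 0 <= psi * \sum_k s k.
  by rewrite mulr_ge0 ?sumr_ge0 ?ltW // => k _; exact: ltW.
have mM : m <= M.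
  by apply: le_trans (ler_norm m) _; rewrite /M -addrA lerDl addr_ge0.
have M0 : 0 <= M by rewrite !addr_ge0.
have lM : l <= penalty M.
  have : psi * \sum_k M * (s k / (s k + M)) <= psi * \sum_k s k.
    rewrite ler_pM2l //; apply: ler_sum => k _.
    have sM : 0 < s k + M by rewrite ltr_wpDr.
    by rewrite mulrCA -[leRHS]mulr1 ler_pM2l // ler_pdivrMr // mul1r lerDr ltW.
  have := ler_norm l; have := normr_ge0 m; rewrite /penalty /M; lra.
have ctn : {within `[m, M], continuous penalty}.
  apply: derivable_within_continuous => x; rewrite in_itv /= => /andP[hx _].
  have did (y : R) : is_derive y 1 (fun x : R => x) 1 := is_derive_id y 1.
  have dsum : is_derive x 1 (fun x : R => \sum_k x * (s k / (s k + x)))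
      (\sum_k (x * (- s k / (s k + x) ^+ 2) + s k / (s k + x) * 1)).
    apply: is_derive_sum_fun => k; apply: is_deriveM_fun (did x) _.
    by apply: is_derive_recip; rewrite gt_eqF ?shift_gt0 ?(lt_le_trans hm).
  by have [] := is_deriveB (did x) (is_deriveMl_fun psi dsum).
have [|c] := IVT (v := l) mM ctn.
  by rewrite ge_min (ltW ml) le_max lM orbT.
rewrite in_itv /= => /andP[mc _] pc; exists c => //.
by rewrite lt_neqAle mc andbT; apply: contraTneq ml => ->; rewrite pc ltxx.
Qed.

End FixedPoint.

(** * Comparing values through the sign of the derivative *)

Section Monotony.
Variables (R : realType).
Implicit Types (f df : R -> R) (a b c m : R).

Lemma le_of_derive_ge0 f df a b : a <= b ->
  (forall x, a <= x -> is_derive x 1 f (df x)) ->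
  (forall x, a <= x -> 0 <= df x) -> f a <= f b.
Proof.
move=> ab fdf df0.
have fdf' x : x \in `]a, b[ -> is_derive x 1 f (df x).
  by rewrite in_itv /= => /andP[/ltW ax _]; exact: fdf.
have ctn : {within `[a, b], continuous f}.
  apply: derivable_within_continuous => x; rewrite in_itv /= => /andP[ax _].
  by have [] := fdf _ ax.
have [c] := MVT_segment ab fdf' ctn.
rewrite in_itv /= => /andP[ac _] E.
by rewrite -subr_ge0 E mulr_ge0 ?subr_ge0 // df0.
Qed.

(** For small h < 0 the difference quotient is still positive, so its numerator is negative; h > a -
    m keeps the point to the right of a. *)
Lemma derive_gt0_lt_left f m c a : is_derive m 1 f c -> 0 < c -> a < m ->
  exists2 x, a < x < m & f x < f m.
Proof.
move=> [df dfc] c0 am.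
have : h^-1 *: (f (h *: 1 + m) - f m) @[h --> 0^'] --> c.
  by rewrite -dfc.
move=> /(cvgr_gt c) /(_ _ c0) h1.
have h2 : \forall h \near 0^'-, 0 < h^-1 *: (f (h *: 1 + m) - f m).
  rewrite near_withinE; move: h1; rewrite near_withinE; apply: filterS.
  by move=> h Ph h0; apply: Ph; rewrite lt_eqF.
have h3 : \forall h \near (0 : R)^'-, a - m < h.
  have am0 : a - m < 0 by rewrite subr_lt0.
  exact: (nbhs_left_gt am0).
have h4 : \forall h \near (0 : R)^'-, h < 0 by exact: nbhs_left_lt.
near (0 : R)^'- => h.
have p1 : 0 < h^-1 *: (f (h *: 1 + m) - f m) by near: h.
have p2 : a - m < h by near: h.
have p3 : h < 0 by near: h.
exists (h + m); first by apply/andP; split; lra.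
move: p1; rewrite /GRing.scale /= mulr1 nmulr_rgt0 ?invr_lt0 //.
by rewrite subr_lt0.
Unshelve. all: by end_near.
Qed.

End Monotony.

(** * The risk as a function of mu *)

Section ScalarRisk.
Variables (R : realType) (n : nat) (s : 'I_n -> R) (psi : R) (k0 : 'I_n).
Variables (a d : 'I_n -> R) (sigma2 kappa : R).
Implicit Types m x : R.
Hypotheses (s_gt0 : forall k, 0 < s k) (s_min : forall k, s k0 <= s k).
Hypotheses (psi_gt0 : 0 < psi) (a_ge0 : forall k, 0 <= a k).
Hypothesis sigma2_ge0 : 0 <= sigma2.

(* [wsum a 2], [2 * wsum d 1] are the bias (up to 1 / (1 - dof2)) and shift terms;
   with [c = 1] the sums are tr (Sigma W^j) for W = (Sigma / m + I)^-1. *)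
Definition wsum (c : 'I_n -> R) j m := \sum_k c k * s k * (m / (s k + m)) ^+ j.
(** For c = d, positivity of this sum at every m >= 0 is condition (A). *)
Definition wsum_deriv (c : 'I_n -> R) m :=
  \sum_k c k * s k * (s k / (s k + m) ^+ 2).

(** When Sigma0 = Sigma, [vtilde] is dof2 / (1 - dof2): the bias then carries the factor [vtilde] +
    1 = 1 / (1 - dof2), and the variance leaves the isolated - sigma2. *)
Definition risk_of m : R :=
  (wsum a 2 m + sigma2) / (1 - dof2 s psi m) - sigma2
  + 2 * wsum d 1 m + kappa.

Lemma is_derive_wsum1 c m : - s k0 < m ->
  is_derive m 1 (wsum c 1) (wsum_deriv c m).
Proof.
move=> hm; apply: is_derive_sum_fun => k; apply: is_deriveMl_fun.
by apply: is_derive_homographic; rewrite gt_eqF // (shift_gt0 s_min).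
Qed.

Lemma is_derive_wsum2 c m : - s k0 < m ->
  is_derive m 1 (wsum c 2)
    (\sum_k c k * s k * (2 * (m / (s k + m)) * (s k / (s k + m) ^+ 2))).
Proof.
move=> hm; apply: is_derive_sum_fun => k; apply: is_deriveMl_fun.
apply: is_derive_sqr_fun; apply: is_derive_homographic.
by rewrite gt_eqF // (shift_gt0 s_min).
Qed.

Lemma continuous_wsum c j m : - s k0 < m -> {for m, continuous (wsum c j)}.
Proof.
move=> hm; apply: cvg_big => [|k _]; first exact: add_continuous.
apply: cvgM; first exact: cvg_cst.
have /is_derive_continuous ctn := is_derive_homographic
  (lt0r_neq0 (shift_gt0 s_min k hm)).
elim: j => [|j IH]; first by under eq_cvg do rewrite expr0; exact: cvg_cst.
by under eq_cvg do rewrite exprS; rewrite exprS; exact: cvgM.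
Qed.

Definition risk_of_deriv m :=
  ((\sum_k a k * s k * (2 * (m / (s k + m)) * (s k / (s k + m) ^+ 2)))
     * (1 - dof2 s psi m)
   + (wsum a 2 m + sigma2) *
     (psi * \sum_k 2 * (s k / (s k + m)) * (- s k / (s k + m) ^+ 2)))
  / (1 - dof2 s psi m) ^+ 2
  + 2 * wsum_deriv d m.

Lemma is_derive_risk_of m : - s k0 < m -> dof2 s psi m != 1 ->
  is_derive m 1 risk_of (risk_of_deriv m).
Proof.
move=> hm; rewrite eq_sym -subr_eq0 => d1.
have dF := is_derive_wsum2 a hm.
have dT := is_deriveD_fun (is_derive_cst_fun 1 m)
  (is_deriveMl_fun (-1) (is_derive_dof2 (s := s) psi s_min hm)).
have dT' : 1 + -1 * dof2 s psi m != 0 by rewrite mulN1r.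
have dI := is_deriveV (f := fun x : R => 1 + -1 * dof2 s psi x) dT' dT.
have dFT := is_deriveM_fun (is_deriveD_fun dF (is_derive_cst_fun sigma2 m)) dI.
have dS := is_deriveD_fun (is_deriveMl_fun 2 (is_derive_wsum1 d hm))
  (is_derive_cst_fun (kappa - sigma2) m).
have := is_deriveD_fun dFT dS.
rewrite (_ : (fun x => _) = risk_of); last first.
  by apply/funext => x; rewrite /risk_of mulN1r; ring.
move=> h; apply: is_derive_eq h _; rewrite /risk_of_deriv /GRing.scale /= mulN1r.
by field.
Qed.

Lemma wsum1_ge0 c m : (forall x, 0 <= x -> 0 <= wsum_deriv c x) -> 0 <= m ->
  0 <= wsum c 1 m.
Proof.
move=> dc0 m0; have <- : wsum c 1 0 = 0.
  by apply: big1 => k _; rewrite mul0r expr1 mulr0.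
apply: le_of_derive_ge0 m0 _ dc0 => x x0; apply: is_derive_wsum1.
by rewrite (lt_le_trans _ x0) // oppr_lt0.
Qed.

Lemma risk_of_ge_kappa m : (forall x, 0 <= x -> 0 <= wsum_deriv d x) ->
  0 <= m -> dof2 s psi m < 1 -> kappa <= risk_of m.
Proof.
move=> dd0 m0 d1; have S0 := wsum1_ge0 dd0 m0.
have F0 : 0 <= wsum a 2 m.
  by apply: sumr_ge0 => k _; rewrite mulr_ge0 ?sqr_ge0 // mulr_ge0 // ltW.
have T0 : 0 <= dof2 s psi m.
  by rewrite mulr_ge0 ?(ltW psi_gt0) // sumr_ge0 // => k _; exact: sqr_ge0.
(* Dividing by 1 - [dof2], which lies in ]0, 1], can only enlarge a nonnegative number. *)
have : sigma2 <= (wsum a 2 m + sigma2) / (1 - dof2 s psi m).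
  rewrite ler_pdivlMr ?subr_gt0 // mulrBr mulr1.
  by have := mulr_ge0 sigma2_ge0 T0; lra.
by rewrite /risk_of; lra.
Qed.

(** The bias is quadratic in the ratios m / (s_k + m), which vanish at 0, so both its value and its
    derivative drop out. *)
Lemma is_derive_risk_of0 : sigma2 = 0 -> dof2 s psi 0 != 1 ->
  is_derive (0 : R) 1 risk_of (2 * wsum_deriv d 0).
Proof.
move=> s0 d1; apply: is_derive_eq (is_derive_risk_of _ d1) _.
  by rewrite oppr_lt0.
have F0 : wsum a 2 0 = 0.
  by apply: big1 => k _; rewrite mul0r expr0n mulr0.
rewrite /risk_of_deriv F0 s0 big1 => [|k _]; last by rewrite mul0r !(mulr0, mul0r).
by rewrite addr0 !mul0r addr0 mul0r add0r.
Qed.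

(** For m >= 0 the ratios lie in [0, 1], so their powers decrease with the exponent. *)
Lemma wsum_le c i j m : (forall k, 0 <= c k) -> (i <= j)%N -> 0 <= m ->
  wsum c j m <= wsum c i m.
Proof.
move=> c0 ij m0; apply: ler_sum => k _; rewrite ler_wpM2l //.
  by rewrite mulr_ge0 // ltW.
have sm : 0 < s k + m by rewrite ltr_wpDr.
apply: ler_wiXn2l => //; first by rewrite divr_ge0 // ltW.
by rewrite ler_pdivrMr // mul1r lerDr ltW.
Qed.

(** Each ratio w = m / (s_k + m) satisfies m w' = w (1 - w), which turns derivatives of sums of
    powers into differences of consecutive sums. *)
Lemma half_deriv_numeratorE m : 0 < m ->
  m ^+ 2 / 2 *
   ((\sum_k a k * s k * (2 * (m / (s k + m)) * (s k / (s k + m) ^+ 2)))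
     * (1 - dof2 s psi m)
   + (wsum a 2 m + sigma2) *
     (psi * \sum_k 2 * (s k / (s k + m)) * (- s k / (s k + m) ^+ 2)))
  = (wsum a 2 m - wsum a 3 m) * penalty s psi m
    + psi * (wsum a 2 m * wsum (fun=> 1) 3 m - wsum (fun=> 1) 2 m * wsum a 3 m
             - sigma2 * (wsum (fun=> 1) 2 m - wsum (fun=> 1) 3 m)).
Proof.
move=> m0.
have sm k : s k + m != 0 by rewrite gt_eqF // addr_gt0.
have E1 :
    m / 2 * \sum_k a k * s k * (2 * (m / (s k + m)) * (s k / (s k + m) ^+ 2)) =
    wsum a 2 m - wsum a 3 m.
  rewrite mulr_sumr -sumrB; apply: eq_bigr => k _; field; exact: sm.
have E2 : m ^+ 2 / 2 * \sum_k 2 * (s k / (s k + m)) * (- s k / (s k + m) ^+ 2)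
    = wsum (fun=> 1) 3 m - wsum (fun=> 1) 2 m.
  rewrite mulr_sumr -sumrB; apply: eq_bigr => k _; field; exact: sm.
(* This identity is what brings lambda, as [penalty], into the derivative. *)
have E3 : m * (1 - dof2 s psi m) = penalty s psi m + psi * wsum (fun=> 1) 2 m.
  have h : \sum_k m * (s k / (s k + m)) - wsum (fun=> 1) 2 m =
      m * \sum_k (s k / (s k + m)) ^+ 2.
    by rewrite mulr_sumr -sumrB; apply: eq_bigr => k _; field; exact: sm.
  by rewrite /penalty mulrBr mulr1 [m * dof2 _ _ _]mulrCA -h; ring.
(* The factor m^2 is split evenly over the first product and goes entirely to the derivative of
   [dof2] in the second; after substitution the F_2 E_2 terms cancel. *)
transitivity (
  (m / 2 * \sum_k a k * s k * (2 * (m / (s k + m)) * (s k / (s k + m) ^+ 2)))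
     * (m * (1 - dof2 s psi m))
   + psi * (wsum a 2 m + sigma2) *
     (m ^+ 2 / 2 * \sum_k 2 * (s k / (s k + m)) * (- s k / (s k + m) ^+ 2))).
  ring.
rewrite E1 E2 E3; ring.
Qed.

Lemma risk_of_deriv_gt0 m : 0 < m -> dof2 s psi m < 1 -> 0 <= penalty s psi m ->
  sigma2 * (wsum (fun=> 1) 2 m - wsum (fun=> 1) 3 m) <=
    wsum a 2 m * wsum (fun=> 1) 3 m - wsum (fun=> 1) 2 m * wsum a 3 m ->
  0 < wsum_deriv d m -> 0 < risk_of_deriv m.
Proof.
move=> m0 d1 pen0 cnd S0; rewrite /risk_of_deriv ltr_wpDl ?mulr_gt0 //.
rewrite divr_ge0 ?sqr_ge0 //.
have c0 : 0 < m ^+ 2 / 2 by rewrite divr_gt0 ?exprn_gt0.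
rewrite -(pmulr_rge0 _ c0) half_deriv_numeratorE // addr_ge0 //.
  by rewrite mulr_ge0 // subr_ge0 wsum_le // ltW.
by rewrite mulr_ge0 ?(ltW psi_gt0) // subr_ge0.
Qed.

(** * Growth of the risk from [m0] = mu(0) on, with [mm] in the role of [mumin] *)

Section Overparametrized.
Variables (mm m0 : R).
Hypotheses (mm_lb : - s k0 < mm) (dof2_mm : dof2 s psi mm = 1).
Hypotheses (mm_m0 : mm < m0) (m0_gt0 : 0 < m0) (pen_m0 : penalty s psi m0 = 0).
Hypothesis wsum_deriv_gt0 : forall x, 0 <= x -> 0 < wsum_deriv d x.
Hypothesis cond : forall m, m0 < m ->
  sigma2 * (wsum (fun=> 1) 2 m - wsum (fun=> 1) 3 m) <=
    wsum a 2 m * wsum (fun=> 1) 3 m - wsum (fun=> 1) 2 m * wsum a 3 m.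

(** The inequality passes to the limit from the right. The endpoint matters because a positive
    derivative at [m0] itself is what yields a smaller risk to its left. *)
Let cond_closed m : m0 <= m ->
  sigma2 * (wsum (fun=> 1) 2 m - wsum (fun=> 1) 3 m) <=
    wsum a 2 m * wsum (fun=> 1) 3 m - wsum (fun=> 1) 2 m * wsum a 3 m.
Proof.
rewrite le_eqVlt => /predU1P[<-|]; last exact: cond.
have m0_lb : - s k0 < m0 by exact: lt_trans mm_lb mm_m0.
pose g m := wsum a 2 m * wsum (fun=> 1) 3 m - wsum (fun=> 1) 2 m * wsum a 3 m
  - sigma2 * (wsum (fun=> 1) 2 m - wsum (fun=> 1) 3 m).
rewrite -subr_ge0 -/(g m0).
have W c j := @continuous_wsum c j m0 m0_lb.
have gm0 : g x @[x --> m0] --> g m0.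
  apply: cvgB.
    by apply: cvgB; apply: cvgM; exact: W.
  by apply: cvgM; [exact: cvg_cst|apply: cvgB; exact: W].
apply: (cvgr_to_ge (cvg_at_right_filter gm0)).
near=> x; rewrite subr_ge0; apply: cond; near: x; exact: nbhs_right_gt.
Unshelve. all: by end_near.
Qed.

Let risk_deriv m : m0 <= m ->
  is_derive m 1 risk_of (risk_of_deriv m) /\ 0 < risk_of_deriv m.
Proof.
move=> m0m; have m_gt0 := lt_le_trans m0_gt0 m0m.
have d1 : dof2 s psi m < 1.
  by rewrite -dof2_mm (dof2_decr s_gt0 s_min) // (lt_le_trans mm_m0).
split.
  apply: is_derive_risk_of; last by rewrite lt_eqF.
  by rewrite (lt_trans _ m_gt0) ?oppr_lt0.
apply: risk_of_deriv_gt0 => //; [|exact: cond_closed|exact/wsum_deriv_gt0/ltW].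
move: m0m; rewrite le_eqVlt => /predU1P[<-|m0m]; first by rewrite pen_m0.
rewrite -pen_m0 ltW // (penalty_incr s_gt0 s_min) // ?(lt_trans mm_lb) //.
by rewrite -dof2_mm ltW // (dof2_decr s_gt0 s_min).
Qed.

Lemma overparam_risk_le m : m0 <= m -> risk_of m0 <= risk_of m.
Proof.
move=> m0m; apply: (@le_of_derive_ge0 _ _ risk_of_deriv) => // x /risk_deriv[]//.
by move=> _ /ltW.
Qed.

Lemma overparam_risk_lt_left : exists2 x, mm < x < m0 & risk_of x < risk_of m0.
Proof.
by have [h1 h2] := risk_deriv (lexx m0); exact: derive_gt0_lt_left h1 h2 mm_m0.
Qed.

End Overparametrized.

(** All ratios m / (s_k + m) tend to 1 and [dof2] tends to 0, so the denominator stays away from 0.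
    This makes the limit defining the extended risk at +oo a genuine one. *)
Lemma cvg_risk_of_pinfty : cvg (risk_of x @[x --> +oo]).
Proof.
have inv0 c : (c + x)^-1 @[x --> +oo] --> (0 : R).
  apply/gtr0_cvgV0.
    by near=> x; rewrite -(subrr c) ltrD2l; near: x; exact/nbhs_pinfty_gt/num_real.
  exact: cvg_addrl.
have small k : s k / (s k + x) @[x --> +oo] --> (0 : R).
  by rewrite -(mulr0 (s k)); apply: cvgM (inv0 _); exact: cvg_cst.
have ratio k : x / (s k + x) @[x --> +oo] --> (1 : R).
  rewrite -(subr0 (1 : R)).
  have h : 1 - s k / (s k + x) @[x --> +oo] --> (1 - 0 : R).
    by apply: cvgB (small k); exact: cvg_cst.
  apply: cvg_trans h; apply: near_eq_cvg; near=> x.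
  have x0 : 0 < x by near: x; exact/nbhs_pinfty_gt/num_real.
  by field; rewrite gt_eqF // addr_gt0.
have wcvg c j : cvg (wsum c j x @[x --> +oo]).
  apply/cvg_ex; exists (\sum_k c k * s k * 1 ^+ j).
  apply: cvg_big => [|k _]; first exact: add_continuous.
  apply: cvgM; first exact: cvg_cst.
  elim: j => [|j IH]; first by under eq_cvg do rewrite expr0; exact: cvg_cst.
  by under eq_cvg do rewrite exprS; rewrite exprS; exact: cvgM IH.
have dcvg : dof2 s psi x @[x --> +oo] --> psi * \sum_(k < n) 0 ^+ 2.
  apply: cvgM; first exact: cvg_cst.
  apply: cvg_big => [|k _]; first exact: add_continuous.
  by rewrite expr2; under eq_cvg do rewrite expr2; exact: cvgM.
apply: is_cvgD; last exact: is_cvg_cst.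
apply: is_cvgD; last by apply: is_cvgM (wcvg _ _); exact: is_cvg_cst.
apply: is_cvgB; last exact: is_cvg_cst.
apply: is_cvgM; first by apply: is_cvgD (wcvg _ _) _; exact: is_cvg_cst.
apply/cvg_ex; exists (1 - psi * \sum_(k < n) 0 ^+ 2)^-1; apply: cvgV.
  by rewrite big1 ?mulr0 ?subr0 ?oner_eq0 // => k _; rewrite expr0n.
by apply: cvgB dcvg; exact: cvg_cst.
Unshelve. all: by end_near.
Qed.

End ScalarRisk.

(** * Translation of the matrix quantities into sums over eigenvalues *)

Lemma tr_outer (R : realType) (p : nat) (x y : 'cV[R]_p) (A : 'M[R]_p) :
  \tr (x *m y^T *m A) = bform y A x.
Proof. by rewrite -mulmxA mxtrace_mulC /bform trace_mx11. Qed.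

Lemma bformBr (R : realType) (p : nat) (x y z : 'cV[R]_p) (A : 'M[R]_p) :
  bform x A (y - z) = bform x A y - bform x A z.
Proof. by rewrite /bform mulmxBr !mxE. Qed.

Section Diagonalized.
Variables (R : realType) (p : nat) (Sigma : 'M[R]_p) (beta beta0 : 'cV[R]_p).
Variables (phi : R) (U : 'M[R[i]]_p) (s : 'I_p -> R) (k0 : 'I_p).
Hypotheses (U_unitary : U \is unitarymx) (Sigma_s : fcalc U Sigma s).
Hypotheses (s_gt0 : forall k, 0 < s k) (s_min : forall k, s k0 <= s k).
Hypothesis phi_gt0 : 0 < phi.
Implicit Types (m l x K sigma : R) (lstar : \bar R).

Let psi := phi / p%:R.
Let a := spectral_weight U beta beta.
(** Unlike those of [a], these weights may have either sign. *)
Let d := spectral_weight U beta (beta0 - beta).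
Let mm := mumin Sigma phi.

Let p_gt0 : 0 < p%:R :> R.
Proof. by rewrite ltr0n; case: (p) k0 => [[]|]. Qed.

Let psi_gt0 : 0 < psi. Proof. exact: divr_gt0. Qed.

Lemma fcalc_ntr A f : fcalc U A f -> phi * ntr A = psi * \sum_k f k.
Proof.
move=> Af; rewrite /ntr (fcalc_tr U_unitary Af) /psi mulrA.
by rewrite [RHS]mulrAC.
Qed.

Lemma fcalc_resolvent m : - s k0 < m ->
  fcalc U (resolvent Sigma m) (fun k => (s k + m)^-1).
Proof.
move=> hm; apply: fcalcV => // [k|].
  by rewrite gt_eqF // (shift_gt0 s_min).
by apply: fcalcD => //; exact: fcalc_scalar.
Qed.

Lemma dof2E m : - s k0 < m ->
  phi * ntr (Sigma ^+ 2 *m resolvent Sigma m ^+ 2) = dof2 s psi m.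
Proof.
move=> hm; have Rm := fcalc_resolvent hm.
rewrite (fcalc_ntr (fcalcM U_unitary (fcalcX U_unitary 2 Sigma_s)
  (fcalcX U_unitary 2 Rm))).
by congr (_ * _); apply: eq_bigr => k _; rewrite exprMn.
Qed.

Lemma penaltyE m : - s k0 < m ->
  m - phi * ntr (m *: (Sigma *m resolvent Sigma m)) = penalty s psi m.
Proof.
move=> hm; have Rm := fcalc_resolvent hm.
by rewrite (fcalc_ntr (fcalcZ m (fcalcM U_unitary Sigma_s Rm))).
Qed.

Lemma rminE : rmin Sigma = s k0.
Proof.
have ev := fcalc_eigenvalueP U_unitary _ Sigma_s.
apply: xget_unique.
  split; first by apply/ev; exists k0.
  by move=> x /ev[k ->].
move=> r [/ev[k ->] h]; apply/le_anti; rewrite s_min andbT.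
by apply: h; apply/ev; exists k0.
Qed.

(** [xget] satisfies its predicate as soon as some root exists, which the intermediate value theorem
    provides. *)
Lemma mumin_spec : - s k0 < mm /\ dof2 s psi mm = 1.
Proof.
have [m hm dm] := exists_dof2_eq1 s_gt0 s_min psi_gt0.
have : [set m | - rmin Sigma < m /\
    1 = phi * ntr (Sigma ^+ 2 *m resolvent Sigma m ^+ 2)] mm.
  by apply: (xgetPex 0); exists m; rewrite /= rminE dof2E.
by rewrite /= rminE => -[h]; rewrite dof2E // => <-.
Qed.

Let mm_lb := mumin_spec.1.
Let dof2_mm := mumin_spec.2.

Lemma gt_mumin_lb m : mm <= m -> - s k0 < m.
Proof. exact: lt_le_trans. Qed.

Lemma dof2_lt1 m : mm < m -> dof2 s psi m < 1.
Proof. by rewrite -dof2_mm; exact: dof2_decr. Qed.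

Lemma penalty_lt m1 m2 : mm <= m1 -> m1 < m2 ->
  penalty s psi m1 < penalty s psi m2.
Proof.
move=> h1; apply: penalty_incr (gt_mumin_lb h1) _ => //.
move: h1; rewrite le_eqVlt => /predU1P[<-|/dof2_lt1/ltW//].
by rewrite dof2_mm.
Qed.

Lemma lambdaminE : lambdamin Sigma phi = penalty s psi mm.
Proof. exact: penaltyE. Qed.

Lemma mufix_spec l : lambdamin Sigma phi < l ->
  mm < mufix Sigma phi l /\ penalty s psi (mufix Sigma phi l) = l.
Proof.
rewrite lambdaminE => hl.
have [m hm pm] := exists_penalty_eq s_gt0 s_min psi_gt0 mm_lb hl.
have : [set m | mumin Sigma phi < m /\
    m = l + phi * ntr (m *: (Sigma *m resolvent Sigma m))] (mufix Sigma phi l).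
  apply: (xgetPex 0); exists m; split => //=; apply/eqP.
  by rewrite -subr_eq penaltyE ?gt_mumin_lb ?ltW // pm.
move=> /= [h /eqP]; rewrite -subr_eq penaltyE ?gt_mumin_lb ?ltW // => /eqP.
by split.
Qed.

(** Strict monotonicity beyond [mumin] makes the root unique. Hence the risk at any chosen mu >
    [mumin] is attained, at lambda = [penalty] mu. *)
Lemma mufix_penalty m : mm < m -> mufix Sigma phi (penalty s psi m) = m.
Proof.
move=> hm.
have [] := @mufix_spec (penalty s psi m).
  by rewrite lambdaminE penalty_lt.
set m' := mufix _ _ _ => h E; apply/eqP; case: ltgtP => // h'.
  by have := penalty_lt (ltW h) h'; rewrite E ltxx.
by have := penalty_lt (ltW hm) h'; rewrite E ltxx.
Qed.

Lemma mufix_ge l1 l2 : lambdamin Sigma phi < l1 -> l1 <= l2 ->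
  mufix Sigma phi l1 <= mufix Sigma phi l2.
Proof.
move=> h1 h12; have [m1 p1] := mufix_spec h1.
have [m2 p2] := mufix_spec (lt_le_trans h1 h12).
rewrite leNgt; apply/negP => /(penalty_lt (ltW m2)).
by rewrite p1 p2 ltNge h12.
Qed.

Lemma riskE sigma2 sigma02 l : lambdamin Sigma phi < l ->
  risk Sigma Sigma beta beta0 sigma2 sigma02 phi l =
  risk_of s psi a d sigma2 (kappa2 Sigma beta beta0 sigma02) (mufix Sigma phi l).
Proof.
move=> hl; have [m_mm _] := mufix_spec hl.
rewrite /risk /bias /variance_term /shift_term /vtilde /=.
move: (mufix Sigma phi l) m_mm => m m_mm.
have m_lb := gt_mumin_lb (ltW m_mm).
have sm k : s k + m != 0 by rewrite gt_eqF // (shift_gt0 s_min).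
have d1 := dof2_lt1 m_mm.
have d1' : 1 - dof2 s psi m != 0 by rewrite subr_eq0 gt_eqF.
have Rm := fcalc_resolvent m_lb.
rewrite -[Sigma *m Sigma]/(Sigma * Sigma) -expr2 dof2E //.
set v := dof2 s psi m / _.
have v1 : v + 1 = (1 - dof2 s psi m)^-1 by rewrite /v; field.
rewrite (fcalc_bform beta (beta0 - beta) (fcalcM U_unitary Rm Sigma_s)).
rewrite (fcalc_bform beta beta (fcalcM U_unitary
  (fcalcM U_unitary Rm (fcalcD (fcalcZ v Sigma_s) Sigma_s)) Rm)).
have -> : m ^+ 2 * \sum_k spectral_weight U beta beta k *
    ((s k + m)^-1 * (v * s k + s k) * (s k + m)^-1) =
  (v + 1) * wsum s a 2 m.
  rewrite !mulr_sumr; apply: eq_bigr => k _; rewrite -/a; field; exact: sm.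
have -> : 2 * m * \sum_k spectral_weight U beta (beta0 - beta) k *
    ((s k + m)^-1 * s k) = 2 * wsum s d 1 m.
  rewrite -mulrA mulr_sumr; congr (_ * _); apply: eq_bigr => k _; rewrite -/d.
  field; exact: sm.
have vE : v = (1 - dof2 s psi m)^-1 - 1 by rewrite -v1 addrK.
by rewrite v1 vE /risk_of; ring.
Qed.

(** Traces against the rank-one B0 and B are bilinear forms, so the gap in (A) is, up to 1 / p, the
    form of Sigma^2 (Sigma + m I)^-2 between beta and beta0 - beta. *)
Lemma aligned_wsum_deriv m : aligned Sigma beta beta0 -> 0 <= m ->
  0 < wsum_deriv s d m.
Proof.
move=> al m0; have := al m m0.
have m_lb : - s k0 < m by rewrite (lt_le_trans _ m0) // oppr_lt0.
have Rm := fcalc_resolvent m_lb.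
have fM := fcalcM U_unitary (fcalcX U_unitary 2 Sigma_s) (fcalcX U_unitary 2 Rm).
rewrite /ntr ltr_pM2r ?invr_gt0 // -!(mulmxA (_ *m _)) !tr_outer.
rewrite -subr_gt0 -bformBr (fcalc_bform _ _ fM).
congr (0 < _); apply: eq_bigr => k _; rewrite -/d; field.
by rewrite gt_eqF // (shift_gt0 s_min).
Qed.

(* The condition has p * sigma2 in place of sigma2 once the normalized traces are
   expanded; since p >= 1 and E_2 >= E_3 this is stronger than what is needed. *)
Lemma overparam_condition_wsum sigma2 m : 0 <= sigma2 ->
  overparam_condition Sigma beta sigma2 phi -> 0 < mufix Sigma phi 0 ->
  mufix Sigma phi 0 < m ->
  sigma2 * (wsum s (fun=> 1) 2 m - wsum s (fun=> 1) 3 m) <=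
    wsum s a 2 m * wsum s (fun=> 1) 3 m - wsum s (fun=> 1) 2 m * wsum s a 3 m.
Proof.
move=> sigma2_ge0 oc m0 m0m; have m_gt0 := lt_trans m0 m0m.
have sm k : 0 < s k + m by rewrite addr_gt0.
have a_ge0 k : 0 <= a k by exact: spectral_weight_ge0.
(* For v = 1 / m the matrix (v Sigma + I)^-1 has the eigenvalues m / (s_k + m). *)
have := oc m^-1; rewrite invr_gt0 ltf_pV2 // => /(_ m_gt0 m0m) /=.
set W := invmx _.
have fW : fcalc U W (fun k => m / (s k + m)).
  rewrite (_ : (fun k => _) = fun k => (m^-1 * s k + 1)^-1).
    apply: fcalcV => // [k|].
      by rewrite gt_eqF // addr_gt0 // mulr_gt0 ?invr_gt0.
    by apply: fcalcD; [exact: fcalcZ|exact: fcalc_scalar].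
  apply/funext => k; field.
  by rewrite !gt_eqF // addrC.
have fSW j := fcalcM U_unitary Sigma_s (fcalcX U_unitary j fW).
rewrite /ntr -!(mulmxA (_ *m _)) !tr_outer.
rewrite !(fcalc_bform _ _ (fSW _)) !(fcalc_tr U_unitary (fSW _)).
have FE j : \sum_k spectral_weight U beta beta k * (s k * (m / (s k + m)) ^+ j)
    = wsum s a j m by apply: eq_bigr => k _; rewrite mulrA.
have EE j : \sum_k s k * (m / (s k + m)) ^+ j = wsum s (fun=> 1) j m.
  by apply: eq_bigr => k _; rewrite mul1r.
rewrite !FE !EE.
have E32 : wsum s (fun=> 1) 3 m <= wsum s (fun=> 1) 2 m.
  by apply: wsum_le => //; exact: ltW.
have E3 : 0 < wsum s (fun=> 1) 3 m.
  rewrite /wsum (bigD1 k0) //=; apply: ltr_pwDl.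
    by rewrite mul1r mulr_gt0 ?exprn_gt0 ?divr_gt0.
  apply: sumr_ge0 => k _.
  by rewrite mul1r mulr_ge0 ?exprn_ge0 ?divr_ge0 // ltW.
have F3 : 0 <= wsum s a 3 m.
  apply: sumr_ge0 => k _; apply: mulr_ge0; first by rewrite mulr_ge0 // ltW.
  by rewrite exprn_ge0 // divr_ge0 // ltW.
move: E32 E3 F3; set e2 := wsum _ _ 2 _; set e3 := wsum _ _ 3 _.
set f2 := wsum _ _ 2 _; set f3 := wsum _ _ 3 _ => E32 E3 F3.
have p1 : 1 <= p%:R :> R by rewrite ler1n; move: p_gt0; rewrite ltr0n.
have Y0 : 0 <= f3 / p%:R + sigma2 by rewrite addr_ge0 ?divr_ge0 ?(ltW p_gt0).
have -> : e2 / p%:R / (e3 / p%:R) = e2 / e3.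
  by field; rewrite !gt_eqF.
(* If this denominator is 0, the left quotient is 0 by the convention on inverses, and it cannot
   exceed e2 / e3 >= 0. *)
move: Y0; rewrite le_eqVlt => /predU1P[<-|Y0].
  by rewrite invr0 mulr0 ltNge divr_ge0 // ?(le_trans _ E32) ?ltW.
rewrite ltr_pdivlMr // mulrAC ltr_pdivrMr // -(ltr_pM2r p_gt0).
have -> : e2 * (f3 / p%:R + sigma2) * p%:R = e2 * f3 + e2 * sigma2 * p%:R.
  by field; rewrite gt_eqF.
have -> : (f2 / p%:R + sigma2) * e3 * p%:R = f2 * e3 + e3 * sigma2 * p%:R.
  by field; rewrite gt_eqF.
have : 0 <= sigma2 * (e2 - e3) * (p%:R - 1).
  by rewrite !mulr_ge0 // subr_ge0.
lra.
Qed.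

(** * Values at mu = 0, signs of [mumin] and [lambdamin], and location of the minimizers *)

Lemma dof2_at0 : dof2 s psi 0 = phi.
Proof.
rewrite /dof2 (eq_bigr (fun=> 1)) => [|k _].
  by rewrite sumr_const card_ord /psi divfK // gt_eqF.
by rewrite addr0 divff ?gt_eqF // expr1n.
Qed.

Lemma penalty_at0 : penalty s psi 0 = 0.
Proof.
by rewrite /penalty big1 ?mulr0 ?subr0 // => k _; rewrite mul0r.
Qed.

(** [dof2] decreases, equals phi at 0 and 1 at [mumin]; comparing phi with 1 therefore gives the
    sign of [mumin]. *)
Lemma mumin_lt0 : phi < 1 -> mm < 0.
Proof.
move=> phi1; rewrite ltNge le_eqVlt; apply/negP => /predU1P[h|h].
  by move: phi1; rewrite -dof2_at0 h dof2_mm ltxx.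
have := dof2_decr s_gt0 s_min psi_gt0 (m1 := 0) _ h.
by rewrite oppr_lt0 => /(_ (s_gt0 _)); rewrite dof2_mm dof2_at0 ltNge ltW.
Qed.

Lemma mumin_gt0 : 1 < phi -> 0 < mm.
Proof.
move=> phi1; rewrite ltNge; apply/negP => h.
move: (phi1); rewrite -dof2_at0 -dof2_mm ltNge.
move: h; rewrite le_eqVlt => /predU1P[->|h]; first by rewrite lexx.
by rewrite ltW // (dof2_decr s_gt0 s_min).
Qed.

Lemma lambdamin_lt0_under : phi < 1 -> lambdamin Sigma phi < 0.
Proof.
by move=> /mumin_lt0 h; rewrite lambdaminE -penalty_at0 penalty_lt.
Qed.

(** Here [mm] > 0 and lambdamin = mm (1 - psi sum s_k / (s_k + mm)). The ratios lie in ]0, 1[, so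
    they exceed their squares, whose sum times psi is [dof2 mm] = 1. *)
Lemma lambdamin_lt0_over : 1 < phi -> lambdamin Sigma phi < 0.
Proof.
move=> /mumin_gt0 h; rewrite lambdaminE /penalty -mulr_sumr mulrCA.
rewrite -[X in X - _]mulr1 -mulrBr pmulr_rlt0 // subr_lt0 -{1}dof2_mm.
rewrite ltr_pM2l //; apply: ltr_sum => [|k _].
  by apply/hasP; exists k0; rewrite ?mem_index_enum.
have sm : 0 < s k + mm by rewrite addr_gt0.
rewrite expr2 gtr_pMr ?divr_gt0 //.
by rewrite ltr_pdivrMr // mul1r ltrDl.
Qed.

Lemma mufix_at0 : phi < 1 -> mufix Sigma phi 0 = 0.
Proof. by move=> /mumin_lt0 h; rewrite -{1}penalty_at0 mufix_penalty. Qed.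

(** K separates the risk at the competitor lambda = [penalty] x from the risk at every finite lambda
    >= 0, hence also from its limit at +oo. *)
Lemma risk_minimizer_lt0 sigma2 sigma02 K x lstar :
  let r := risk_of s psi a d sigma2 (kappa2 Sigma beta beta0 sigma02) in
  lambdamin Sigma phi < 0 ->
  mm < x < mufix Sigma phi 0 -> r x < K ->
  (forall m, mufix Sigma phi 0 <= m -> K <= r m) ->
  risk_minimizer Sigma Sigma beta beta0 sigma2 sigma02 phi lstar ->
  (lstar < 0)%E.
Proof.
move=> r lmin0 /andP[mmx xm0] rxK Kr [lb mini].
have lx : lambdamin Sigma phi < penalty s psi x.
  by rewrite lambdaminE penalty_lt.
have rK l : 0 <= l -> K <= risk Sigma Sigma beta beta0 sigma2 sigma02 phi l.
  by move=> l0; rewrite riskE ?(lt_le_trans lmin0) // Kr // mufix_ge.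
have := mini (penalty s psi x)%:E; rewrite lee_fin => /(_ (ltW lx)).
rewrite /risk_ext (gt_eqF lx) riskE // mufix_penalty // -/(r x).
case: lstar lb {mini} => [l _|_|//].
  have [l0 _|l0] := ltP l 0; first by rewrite lte_fin.
  rewrite gt_eqF ?(lt_le_trans lmin0) // lee_fin.
  by move=> /(le_trans (rK _ l0)) /(lt_le_trans rxK); rewrite ltxx.
(* What remains is [lstar] = +oo, where the extended risk is a limit. *)
move=> h; exfalso; move: h; apply/negP; rewrite -ltNge.
apply: (@lt_le_trans _ _ K%:E); first by rewrite lte_fin.
have mu_y : mufix Sigma phi l @[l --> +oo] --> +oo.
  apply/cvgryPge => A; near=> l.
  (* The maximum keeps the threshold beyond [mumin], where [mufix] inverts [penalty]. *)
  have hA : mm < Num.max A (mm + 1) by rewrite lt_max ltrDl ltr01 orbT.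
  rewrite (@le_trans _ _ (Num.max A (mm + 1))) ?le_max ?lexx //.
  rewrite -(mufix_penalty hA); apply: mufix_ge.
    by rewrite lambdaminE penalty_lt.
  by near: l; exact/nbhs_pinfty_ge/num_real.
have r_y : cvg (r (mufix Sigma phi l) @[l --> +oo]).
  have /cvg_ex[c hc] : cvg (r m @[m --> +oo]) by exact: cvg_risk_of_pinfty.
  by apply/cvg_ex; exists c; exact: (cvg_comp _ _ mu_y hc).
have risk_y : cvg (risk Sigma Sigma beta beta0 sigma2 sigma02 phi l @[l --> +oo]).
  move/cvg_ex: r_y => [c hc]; apply/cvg_ex; exists c; apply: cvg_trans hc.
  apply: near_eq_cvg; near=> l; rewrite riskE //.
  by near: l; exact/nbhs_pinfty_gt/num_real.
apply: lime_ge.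
  move/cvg_ex: risk_y => [c hc]; apply/cvg_ex; exists c%:E.
  by apply: cvg_EFin hc; near=> l.
near=> l; rewrite lee_fin rK //; near: l; exact/nbhs_pinfty_ge/num_real.
Unshelve. all: by end_near.
Qed.

Lemma underparam_minimizer_lt0 sigma02 : phi < 1 -> aligned Sigma beta beta0 ->
  exists2 sbar2 : R, 0 < sbar2 &
    forall sigma2, 0 <= sigma2 -> sigma2 < sbar2 -> forall lstar,
      risk_minimizer Sigma Sigma beta beta0 sigma2 sigma02 phi lstar ->
      (lstar < 0)%E.
Proof.
move=> phi1 al; have mm0 := mumin_lt0 phi1.
have dd x (x0 : 0 <= x) := aligned_wsum_deriv al x0.
have a_ge0 k : 0 <= a k by exact: spectral_weight_ge0.
set kappa := kappa2 Sigma beta beta0 sigma02.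
have dr : is_derive (0 : R) 1 (risk_of s psi a d 0 kappa) (2 * wsum_deriv s d 0).
  by apply: (is_derive_risk_of0 _ _ _ s_gt0 s_min) => //; rewrite dof2_at0 lt_eqF.
have dr0 : 0 < 2 * wsum_deriv s d 0 by rewrite mulr_gt0 // dd.
(* The point x is chosen for the noiseless risk, so that it does not depend on sigma2. *)
have [x /andP[mmx x0] rx] := derive_gt0_lt_left dr dr0 mm0.
have r0 : risk_of s psi a d 0 kappa 0 = kappa.
  rewrite /risk_of /wsum !big1 => [|k _|k _]; rewrite ?mul0r ?expr0n ?mulr0 //.
  by rewrite !(addr0, mulr0, mul0r, subr0, add0r).
rewrite r0 in rx; have d1 := dof2_lt1 mmx.
(* At x, noise raises the risk by sigma2 / (1 - dof2) - sigma2, which is at most sigma2 / (1 -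
   dof2); this bound keeps the increase below the gap to kappa. *)
exists ((kappa - risk_of s psi a d 0 kappa x) * (1 - dof2 s psi x)).
  by rewrite mulr_gt0 ?subr_gt0.
move=> sigma2 sigma2_ge0; rewrite -ltr_pdivrMr ?subr_gt0 // => small lstar.
apply: (risk_minimizer_lt0 (K := kappa) (x := x)) => //.
- exact: lambdamin_lt0_under.
- by rewrite mufix_at0 // mmx.
- move: small; rewrite -/kappa /risk_of !mulrDl mul0r; lra.
- rewrite mufix_at0 // => m m0; apply: (risk_of_ge_kappa _ s_gt0 s_min) => //.
    by move=> y y0; exact/ltW/dd.
  by rewrite dof2_lt1 // (lt_le_trans mm0).
Qed.

Lemma overparam_minimizer_lt0 sigma2 sigma02 lstar : 0 <= sigma2 -> 1 < phi ->
  aligned Sigma beta beta0 -> overparam_condition Sigma beta sigma2 phi ->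
  risk_minimizer Sigma Sigma beta beta0 sigma2 sigma02 phi lstar ->
  (lstar < 0)%E.
Proof.
move=> sigma2_ge0 phi1 al oc; have lmin0 := lambdamin_lt0_over phi1.
have [m0_mm pen0] := mufix_spec lmin0.
have m0_gt0 := lt_trans (mumin_gt0 phi1) m0_mm.
have dd x (x0 : 0 <= x) := aligned_wsum_deriv al x0.
have a_ge0 k : 0 <= a k by exact: spectral_weight_ge0.
have cnd m (hm : mufix Sigma phi 0 < m) :=
  overparam_condition_wsum sigma2_ge0 oc m0_gt0 hm.
have [x hx rx] := overparam_risk_lt_left (kappa2 Sigma beta beta0 sigma02)
  s_gt0 s_min psi_gt0 a_ge0 mm_lb dof2_mm m0_mm m0_gt0 pen0 dd cnd.
apply: (risk_minimizer_lt0 lmin0 hx rx) => m hm.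
exact: (overparam_risk_le _ s_gt0 s_min psi_gt0 a_ge0 mm_lb dof2_mm m0_mm m0_gt0).
Qed.

End Diagonalized.

Theorem theorem3 (R : realType) (p : nat) (hp : (0 < p)%N)
    (Sigma Sigma0 : 'M[R]_p) (beta beta0 : 'cV[R]_p) (phi sigma02 c C : R)
    (hsym : Sigma^T = Sigma) (hc : 0 < c)
    (hspec : forall a : R, eigenvalue Sigma a -> c <= a <= C)
    (hphi : 0 < phi) (hsigma02 : 0 <= sigma02)
    (hSigma0 : Sigma0 = Sigma) (hbeta : beta0 <> beta) :
  (phi < 1 -> aligned Sigma beta beta0 ->
     exists2 sbar2 : R, 0 < sbar2 &
       forall sigma2 : R, 0 <= sigma2 -> sigma2 < sbar2 ->
       forall lstar : \bar R,
         risk_minimizer Sigma Sigma0 beta beta0 sigma2 sigma02 phi lstar ->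
         (lstar < 0)%E)
  /\
  (forall sigma2 : R, 0 <= sigma2 ->
     1 < phi -> aligned Sigma beta beta0 ->
     overparam_condition Sigma beta sigma2 phi ->
     forall lstar : \bar R,
       risk_minimizer Sigma Sigma0 beta beta0 sigma2 sigma02 phi lstar ->
       (lstar < 0)%E).
Proof.
rewrite {}hSigma0; have [U [s [U_unitary Sigma_s]]] := symmetric_fcalc hsym.
have s_gt0 k : 0 < s k.
  have /hspec/andP[cs _] : eigenvalue Sigma (s k).
    by apply/(fcalc_eigenvalueP U_unitary _ Sigma_s); exists k.
  exact: lt_le_trans cs.
pose k0 := [arg min_(k < Ordinal hp) s k]%O.
have s_min k : s k0 <= s k by rewrite /k0; case: arg_minP => // i _; exact.
split=> [phi1 al|sigma2 sigma2_ge0 phi1 al oc lstar].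
  exact: (underparam_minimizer_lt0 U_unitary Sigma_s s_gt0 s_min).
exact: (overparam_minimizer_lt0 U_unitary Sigma_s s_gt0 s_min).
Qed.
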